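(* Let $n\ge 2$ be a natural number and let $m=2^n$. Let $\Gamma_m$ be the undirected simple graph on the $m+6$ vertices $\{1,2,\ldots,m+6\}$ defined in the context. Then $\mathrm{Aut}(\Gamma_m)\simeq \mathbb{Z}/m\mathbb{Z}$, i.e. the full automorphism group of $\Gamma_m$ is cyclic of order $m=2^n$.
   Context: All graphs are undirected and simple. For $k\in\mathbb{N}$ let $V_k=\{1,2,\ldots,k\}$. We write $i\sim j$ when the vertices $i$ and $j$ are adjacent. $\mathrm{Aut}(\Gamma)$ denotes the group of all graph automorphisms (adjacency-preserving vertex permutations) of $\Gamma$. For $n\ge 2$ and $m=2^n$, the graph $\Gamma_m$ has vertex set $V_{m+6}=\{1,2,\ldots,m+6\}$ and exactly the following edges: (1) $i\sim i+1$ for all $i\in V_{m-1}$, and $1\sim m$ (so the subgraph induced on $\{1,\ldots,m\}$ is a cycle of length $m$); (2) for $i\in V_m$: $m+1\sim i$ if and only if $i\equiv 1$ or $2\pmod 4$; (3) for $i\in V_m$: $m+2\sim i$ if and only if $i\equiv 2$ or $3\pmod 4$; (4) for $i\in V_m$: $m+3\sim i$ if and only if $i\equiv 3$ or $0\pmod 4$; (5) for $i\in V_m$: $m+4\sim i$ if and only if $i\equiv 0$ or $1\pmod 4$; (6) for $i\in V_m$: $m+5\sim i$ if and only if $i\equiv 1\pmod 2$; (7) for $i\in V_m$: $m+6\sim i$ if and only if $i\equiv 0\pmod 2$; (8) $m+1\sim m+5$, $m+5\sim m+3$, $m+2\sim m+6$, $m+6\sim m+4$. There are no other edges. *)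

(* Defs.v *)
From mathcomp Require Import all_boot all_algebra all_fingroup.

Set Implicit Arguments.
Unset Strict Implicit.
Unset Printing Implicit Defensive.

Definition graph_aut_set (T : finType) (e : rel T) : {set {perm T}} :=
  [set s : {perm T} | [forall x, forall y, e (s x) (s y) == e x y]].

Lemma graph_autP (T : finType) (e : rel T) (s : {perm T}) :
  reflect (forall x y, e (s x) (s y) = e x y) (s \in graph_aut_set e).
Proof.
rewrite inE; apply: (iffP forallP) => [h x y | h x].
  by move/forallP: (h x) => /(_ y)/eqP.
by apply/forallP => y; rewrite h.
Qed.

Lemma graph_aut_group_set (T : finType) (e : rel T) :
  group_set (graph_aut_set e).
Proof.
apply/group_setP; split; first by apply/graph_autP => x y; rewrite !perm1.
move=> s t /graph_autP hs /graph_autP ht.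
by apply/graph_autP => x y; rewrite !permM ht hs.
Qed.

Definition graph_aut (T : finType) (e : rel T) : {group {perm T}} :=
  Group (graph_aut_group_set e).

(* V k is the set of labels {1, ..., k}. *)
Definition V (k : nat) : pred nat := [pred i | 0 < i <= k].

(* Each edge of the graph, listed in one orientation, on the labels
   1, ..., m + 6. *)
Definition Gamma_arc (m : nat) (i j : nat) : bool :=
  [|| (i \in V (m - 1)) && (j == i + 1),
      (i == 1) && (j == m),
      [&& i == m + 1, j \in V m & (j == 1 %[mod 4]) || (j == 2 %[mod 4])],
      [&& i == m + 2, j \in V m & (j == 2 %[mod 4]) || (j == 3 %[mod 4])],
      [&& i == m + 3, j \in V m & (j == 3 %[mod 4]) || (j == 0 %[mod 4])],
      [&& i == m + 4, j \in V m & (j == 0 %[mod 4]) || (j == 1 %[mod 4])],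
      [&& i == m + 5, j \in V m & j == 1 %[mod 2]],
      [&& i == m + 6, j \in V m & j == 0 %[mod 2]],
      (i == m + 1) && (j == m + 5),
      (i == m + 5) && (j == m + 3),
      (i == m + 2) && (j == m + 6) |
      (i == m + 6) && (j == m + 4)].

(* The element x of 'I_(m + 6) = {0, ..., m + 5} carries the label x.+1. *)
Definition Gamma (m : nat) : rel 'I_(m + 6) :=
  [rel x y : 'I_(m + 6) | Gamma_arc m x.+1 y.+1 || Gamma_arc m y.+1 x.+1].

Lemma Gamma_sym (m : nat) : symmetric (@Gamma m).
Proof. by move=> x y; rewrite /Gamma /= orbC. Qed.

Lemma Gamma_irrefl (m : nat) : 1 < m -> irreflexive (@Gamma m).
Proof.
move=> m_gt1 x; rewrite /Gamma /= orbb; apply/negP; rewrite /Gamma_arc.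
move: (nat_of_ord x).+1 => i.
have big k : 0 < k -> (m + k \in V m) = false.
  move=> k_gt0; apply/negP; rewrite inE => /andP[_].
  by rewrite leqNgt -[ltnLHS]addn0 ltn_add2l k_gt0.
have neq a b : a != b -> (i == m + a) && (i == m + b) = false.
  move=> ab; apply/negP => /andP[/eqP->]; rewrite eqn_add2l.
  exact/negP.
rewrite !neq // !orbF.
have in_V k b : 0 < k -> [&& i == m + k, i \in V m & b] = false.
  by move=> /big hk; apply/negP => /and3P[/eqP->]; rewrite hk.
rewrite !in_V // !orbF => /orP[/andP[_]|/andP[/eqP-> /eqP m1]].
  by rewrite -[eqbLHS]addn0 eqn_add2l.
by rewrite -m1 in m_gt1.
Qed.

(* Main.v *)
Require Import Defs.
From mathcomp Require Import all_boot all_algebra all_fingroup.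
From mathcomp Require Import all_solvable zify.

Set Implicit Arguments.
Unset Strict Implicit.
Unset Printing Implicit Defensive.

(** Write m = 4 (k + 1).  The vertices fall into three families, each
indexed by all natural numbers with the index read modulo a period: the cycle
[cyc i] (period m), the four hubs [hub a] (period 4, adjacent to the classes a
and a + 1 modulo 4 of the cycle) and the two poles [pole b] (period 2).  In
these coordinates every adjacency depends only on the difference of the
indices, so that adding 1 to all indices is an automorphism, the rotation, and
its order is m.

Conversely, every automorphism is a power of the rotation.  The point is that
the three families can be recovered from the graph alone.
- The two poles are not adjacent and have no common neighbour, while any other
  two distinct nonadjacent vertices have one ([remote_is_pole]); so
  automorphisms permute the poles.
- A cycle vertex i + 1, the vertex i and the hub i form a triangle, and the
  pole next to i + 1 is next to neither of the other two.  No hub lies on such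
  a triangle: its only triangles without a pole use two consecutive cycle
  vertices, which have different parities ([triangle_cyc]).  So automorphisms
  preserve the cycle, hence also the hubs.
- An automorphism that fixes i on the cycle fixes the pole i next to it, then
  the hub i, the only hub next to both, then i + 1, the neighbour of i on the
  cycle that is next to this hub ([aut_fix_next]).  By induction, an
  automorphism that fixes one cycle vertex is the identity.
Composing an automorphism with a power of the rotation makes it fix the vertex
0 of the cycle.  (Degrees would not do for the second point: when m = 8, hubs
and cycle vertices all have degree 5.) *)

(** * Periodic coordinates on the vertices *)

Lemma cyc_subproof k i : i %% (4 * k.+1) < 4 * k.+1 + 6.
Proof. by rewrite ltn_addr // ltn_pmod. Qed.

Lemma hub_subproof k a : 4 * k.+1 + a %% 4 < 4 * k.+1 + 6.
Proof. lia. Qed.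

Lemma pole_subproof k b : 4 * k.+1 + 4 + b %% 2 < 4 * k.+1 + 6.
Proof. lia. Qed.

Definition cyc k i : 'I_(4 * k.+1 + 6) := Ordinal (cyc_subproof k i).
Definition hub k a : 'I_(4 * k.+1 + 6) := Ordinal (hub_subproof k a).
Definition pole k b : 'I_(4 * k.+1 + 6) := Ordinal (pole_subproof k b).

Variant vertex_spec k : 'I_(4 * k.+1 + 6) -> Type :=
  | IsCyc i : vertex_spec (cyc k i)
  | IsHub a : vertex_spec (hub k a)
  | IsPole b : vertex_spec (pole k b).

Lemma vertexP k x : @vertex_spec k x.
Proof.
have [xm | mx] := ltnP x (4 * k.+1).
  have -> : x = cyc k x by apply: val_inj; rewrite /= modn_small.
  by constructor.
have [xm | mx'] := ltnP x (4 * k.+1 + 4).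
  have -> : x = hub k (x - 4 * k.+1) by apply: val_inj => /=; lia.
  by constructor.
have -> : x = pole k (x - (4 * k.+1 + 4)).
  by apply: val_inj => /=; have := ltn_ord x; lia.
by constructor.
Qed.

(** * Adjacency in these coordinates *)

Lemma modm4 k i : i %% (4 * k.+1) %% 4 = i %% 4.
Proof. by rewrite modn_dvdm // dvdn_mulr. Qed.

Lemma eq_mod4 k i j : i = j %[mod 4 * k.+1] -> i = j %[mod 4].
Proof. by move=> ij; rewrite -(modm4 k i) ij modm4. Qed.

Lemma succ_modm m i j : 0 < m -> (i.+1 == j %[mod m]) =
  (i %% m + 1 == j %% m) || (i %% m + 1 == m) && (j %% m == 0).
Proof.
move=> m_gt0; rewrite -addn1 -modnDml.
have := ltn_pmod i m_gt0; have := ltn_pmod j m_gt0.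
move: (i %% m) (j %% m) => r s s_lt; rewrite leq_eqVlt => /orP[/eqP r_m|r_lt].
  by rewrite addn1 r_m modnn eqxx; lia.
by rewrite modn_small; lia.
Qed.

Lemma eq_cyc k i j : (cyc k i == cyc k j) = (i == j %[mod 4 * k.+1]).
Proof. by []. Qed.

Lemma eq_hub k a b : (hub k a == hub k b) = (a == b %[mod 4]).
Proof. by rewrite -val_eqE /= eqn_add2l. Qed.

Lemma eq_pole k a b : (pole k a == pole k b) = (a == b %[mod 2]).
Proof. by rewrite -val_eqE /= eqn_add2l. Qed.

Local Notation adj := (@Gamma _).

Lemma adjC k (x y : 'I_(4 * k.+1 + 6)) : adj x y = adj y x.
Proof. exact: Gamma_sym. Qed.

(** The elements below m form the rim of the graph, the cycle; the element
m + c outside it is a hub for c < 4 and a pole for c = 4, 5.  An element is one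
less than its label, so the residue classes in the description of the edges are
all shifted down by one. *)
Lemma arc_from_rim m i j : i < m -> Gamma_arc m i.+1 j.+1 =
  (i.+1 == j) && (j < m) || (i == 0) && (j.+1 == m).
Proof.
move=> im; have no c : (i.+1 == m + c.+1) = false by lia.
by rewrite /Gamma_arc !no !inE /= !orbF; lia.
Qed.

Lemma arc_from_outside m c j : 0 < m -> c < 6 ->
  Gamma_arc m (m + c).+1 j.+1 =
  [|| (j < m) && (if c < 4 then (j == c %[mod 4]) || (j == c.+1 %[mod 4])
                  else j == c %[mod 2]),
      (c == 0) && (j == m + 4), (c == 4) && (j == m + 2),
      (c == 1) && (j == m + 5) | (c == 5) && (j == m + 3)].
Proof.
move=> m_gt0 c6; rewrite -addnS /Gamma_arc !eqn_add2l !inE.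
have -> : (m + c.+1 <= m - 1) = false by lia.
have -> : (m + c.+1 == 1) = false by lia.
rewrite andbF /= -!(addn1 j).
by case: c c6 => [|[|[|[|[|[|c]]]]]] //= _; lia.
Qed.

Lemma adj_rim m (x y : 'I_(m + 6)) : x < m -> y < m -> adj x y =
  [|| x.+1 == y, y.+1 == x, (x == 0 :> nat) && (y.+1 == m)
    | (y == 0 :> nat) && (x.+1 == m)].
Proof. by move=> xm ym; rewrite /Gamma /= !arc_from_rim // xm ym; lia. Qed.

Lemma adj_rim_outside m (x y : 'I_(m + 6)) c :
  x < m -> y = m + c :> nat -> c < 6 -> adj x y =
  if c < 4 then (x == c %[mod 4]) || (x == c.+1 %[mod 4])
  else x == c %[mod 2].
Proof.
move=> xm yc c6; rewrite /Gamma /= yc arc_from_rim // ?arc_from_outside //;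
  last lia.
have no d : (x == m + d :> nat) = false by lia.
rewrite !no !andbF !orbF xm /=.
have -> : (x.+1 == m + c) && (m + c < m) = false by lia.
have -> : ((m + c).+1 == m) = false by lia.
by rewrite andbF.
Qed.

Lemma adj_outside m (x y : 'I_(m + 6)) c d : 0 < m ->
  x = m + c :> nat -> y = m + d :> nat -> c < 6 -> d < 6 -> adj x y =
  (c < 4) && (4 <= d) && (c == d %[mod 2]) ||
  (d < 4) && (4 <= c) && (c == d %[mod 2]).
Proof.
move=> m_gt0 xc yd c6 d6; rewrite /Gamma /= xc yd.
rewrite !arc_from_outside // !eqn_add2l.
have -> : (m + c < m) = false by lia.
have -> : (m + d < m) = false by lia.
by case: c c6 {xc} => [|[|[|[|[|[|c]]]]]] //= _;
  case: d d6 {yd} => [|[|[|[|[|[|d]]]]]].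
Qed.

Lemma adj_cyc k i j : adj (cyc k i) (cyc k j) =
  (i.+1 == j %[mod 4 * k.+1]) || (j.+1 == i %[mod 4 * k.+1]).
Proof.
rewrite adj_rim ?ltn_pmod // !succ_modm //=.
move: (i %% (4 * _)) (j %% (4 * _)) => r s; lia.
Qed.

Lemma adj_cyc_hub k i a : adj (cyc k i) (hub k a) =
  (i == a %[mod 4]) || (i == a.+1 %[mod 4]).
Proof.
rewrite (@adj_rim_outside _ _ _ (a %% 4)) ?ltn_pmod //=; last by lia.
by rewrite modm4; lia.
Qed.

Lemma adj_cyc_pole k i b : adj (cyc k i) (pole k b) = (i == b %[mod 2]).
Proof.
rewrite (@adj_rim_outside _ _ _ (4 + b %% 2)) ?ltn_pmod //= ?addnA //;
  last by lia.
by have := modm4 k i; move: (i %% (4 * _)) => r; lia.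
Qed.

Lemma adj_hub k a b : adj (hub k a) (hub k b) = false.
Proof. by rewrite (@adj_outside _ _ _ (a %% 4) (b %% 4)) //; lia. Qed.

Lemma adj_hub_pole k a b : adj (hub k a) (pole k b) = (a == b %[mod 2]).
Proof.
by rewrite (@adj_outside _ _ _ (a %% 4) (4 + b %% 2)) //= ?addnA //; lia.
Qed.

Lemma adj_pole k a b : adj (pole k a) (pole k b) = false.
Proof.
by rewrite (@adj_outside _ _ _ (4 + a %% 2) (4 + b %% 2)) //= ?addnA //; lia.
Qed.

Lemma adj_hub_cyc k a i : adj (hub k a) (cyc k i) =
  (i == a %[mod 4]) || (i == a.+1 %[mod 4]).
Proof. by rewrite adjC adj_cyc_hub. Qed.

Lemma adj_pole_cyc k b i : adj (pole k b) (cyc k i) = (i == b %[mod 2]).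
Proof. by rewrite adjC adj_cyc_pole. Qed.

Lemma adj_pole_hub k b a : adj (pole k b) (hub k a) = (a == b %[mod 2]).
Proof. by rewrite adjC adj_hub_pole. Qed.

Definition adjE := (adj_cyc, adj_cyc_hub, adj_cyc_pole, adj_hub_cyc, adj_hub,
  adj_hub_pole, adj_pole_cyc, adj_pole_hub, adj_pole).

(** * The poles are the only vertices at distance more than two *)

Definition remote (T : finType) (e : rel T) : rel T := fun x y =>
  [&& x != y, ~~ e x y & [forall z, ~~ (e x z && e y z)]].

Lemma remote_aut (T : finType) (e : rel T) (s : {perm T}) x y :
  s \in graph_aut e -> remote e x y -> remote e (s x) (s y).
Proof.
move=> /graph_autP s_aut /and3P[xy nxy /forallP no_nb].
rewrite /remote (inj_eq perm_inj) xy s_aut nxy; apply/forallP => z.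
by rewrite -(permKV s z) !s_aut no_nb.
Qed.

Lemma remote_nb (T : finType) (e : rel T) x y z :
  remote e x y -> ~~ (e x z && e y z).
Proof. by move=> /and3P[_ _ /forallP]. Qed.

Lemma remote_pole k b : remote adj (pole k b) (pole k b.+1).
Proof.
rewrite /remote eq_pole adjE; apply/and3P; split; [lia | by [] |].
by apply/forallP => z; case: (vertexP z) => [i|a|c]; rewrite !adjE; lia.
Qed.

(** In each case the pair consists of distinct nonadjacent vertices and a
common neighbour is exhibited: a pole when the parities agree, otherwise a hub
or a cycle vertex next to both. *)
Lemma remote_is_pole k (x y : 'I_(4 * k.+1 + 6)) :
  remote adj x y -> exists b, x = pole k b.
Proof.
case: (vertexP x) => [i|a|b]; last by exists b.
- case: (vertexP y) => [j|b|b] rxy.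
  + have [ij|ij] := boolP (j == i %[mod 2]).
      by have := remote_nb (pole k i) rxy; rewrite !adjE eqxx ij.
    have [ij4|ij4] := boolP (j == i.+1 %[mod 4]).
      by have := remote_nb (hub k i) rxy; rewrite !adjE; lia.
    by have := remote_nb (hub k j) rxy; rewrite !adjE; lia.
  + have /and3P[_ nadj _] := rxy; rewrite adjE in nadj.
    have [ib|ib] := boolP (i == b %[mod 2]).
      by have := remote_nb (pole k i) rxy; rewrite !adjE; lia.
    by have := remote_nb (cyc k i.+1) rxy; rewrite !adjE eqxx /=; lia.
  + have /and3P[_ nadj _] := rxy; rewrite adjE in nadj.
    by have := remote_nb (cyc k i.+1) rxy; rewrite !adjE eqxx /=; lia.
- case: (vertexP y) => [j|b|b] rxy; have /and3P[nxy nadj _] := rxy;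
    rewrite adjE in nadj.
  + have [ja|ja] := boolP (j == a %[mod 2]).
      by have := remote_nb (pole k j) rxy; rewrite !adjE; lia.
    by have := remote_nb (cyc k j.+1) rxy; rewrite !adjE eqxx /=; lia.
  + rewrite eq_hub in nxy.
    have [ab|ab] := boolP (a == b %[mod 2]).
      by have := remote_nb (pole k a) rxy; rewrite !adjE; lia.
    have [ab4|ab4] := boolP (b == a.+1 %[mod 4]).
      by have := remote_nb (cyc k b) rxy; rewrite !adjE; lia.
    by have := remote_nb (cyc k a) rxy; rewrite !adjE; lia.
  + by have := remote_nb (cyc k a.+1) rxy; rewrite !adjE; lia.
Qed.

Lemma aut_pole k s b : s \in graph_aut (@Gamma (4 * k.+1)) ->
  exists c, s (pole k b) = pole k c.
Proof.
by move=> s_aut; apply: remote_is_pole (remote_aut s_aut (remote_pole k b)).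
Qed.

(** * Automorphisms preserve the cycle and the hubs *)

(** Two poles are never adjacent, so [x] is not a pole.  If [x] is a hub, the
pole [b] has its parity; a pole among [y] and [z] would be the same one and so
would be adjacent to the other, and two cycle vertices would be consecutive,
hence one of them adjacent to the pole. *)
Lemma triangle_cyc k b (x y z : 'I_(4 * k.+1 + 6)) :
  adj x y -> adj y z -> adj z x ->
  adj (pole k b) x -> ~~ adj (pole k b) y -> ~~ adj (pole k b) z ->
  exists i, x = cyc k i.
Proof.
case: (vertexP x) => [i|a|c]; first by exists i.
- case: (vertexP y) => [i|c|c]; case: (vertexP z) => [j|d|d]; rewrite !adjE //.
  + move=> _ ij _ ab ib jb.
    have {ij} : (i.+1 == j %[mod 4]) || (j.+1 == i %[mod 4]).
      by case/orP: ij => /eqP/eq_mod4->; rewrite eqxx ?orbT.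
    lia.
  + by lia.
  + by lia.
by rewrite !adjE.
Qed.

Lemma aut_cyc k s i : s \in graph_aut (@Gamma (4 * k.+1)) ->
  exists j, s (cyc k i) = cyc k j.
Proof.
move=> s_aut; have /graph_autP s_adj := s_aut.
have [j ->] : exists j, cyc k i = cyc k j.+1.
  (* i - 1 modulo m *)
  exists (i + (4 * k.+1).-1); apply/eqP.
  by rewrite eq_cyc -addnS prednK // modnDr.
have [c sc] := aut_pole j.+1 s_aut.
apply: (@triangle_cyc _ c _ (s (cyc k j)) (s (hub k j)));
  rewrite -?sc s_adj !adjE ?eqxx ?orbT //; lia.
Qed.

Lemma aut_hub k s a : s \in graph_aut (@Gamma (4 * k.+1)) ->
  exists b, s (hub k a) = hub k b.
Proof.
move=> s_aut; have s'_aut := groupVr s_aut.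
case E: _ / (vertexP (s (hub k a))) => [i|b|b]; last 1 first.
- have [c] := aut_pole b s'_aut; rewrite -E permK => /(congr1 val)/=; lia.
- have [j] := aut_cyc i s'_aut; rewrite -E permK => /(congr1 val)/= h.
  by have := ltn_pmod j (isT : 0 < 4 * k.+1); lia.
- by exists b.
Qed.

(** * An automorphism fixing a cycle vertex is the identity *)

(** The hubs next to [cyc i] are i and i - 1, which the pole i separates; the
neighbours of [cyc i] on the cycle are i + 1 and i - 1, which the hub i
separates since i - 1 differs from i and i + 1 modulo 4. *)
Lemma aut_fix_next k s i : s \in graph_aut (@Gamma (4 * k.+1)) ->
  s (cyc k i) = cyc k i ->
  [/\ s (cyc k i.+1) = cyc k i.+1, s (hub k i) = hub k i
    & s (pole k i) = pole k i].
Proof.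
move=> s_aut s_i; have /graph_autP s_adj := s_aut.
have s_pole : s (pole k i) = pole k i.
  have [c sc] := aut_pole i s_aut; rewrite sc; apply/eqP; rewrite eq_pole.
  by have := s_adj (cyc k i) (pole k i); rewrite s_i sc !adjE; lia.
have s_hub : s (hub k i) = hub k i.
  have [a sa] := aut_hub i s_aut; rewrite sa; apply/eqP; rewrite eq_hub.
  have := s_adj (cyc k i) (hub k i); have := s_adj (hub k i) (pole k i).
  by rewrite s_i s_pole sa !adjE; lia.
split=> //; have [j sj] := aut_cyc i.+1 s_aut; rewrite sj; apply/eqP.
have := s_adj (cyc k i) (cyc k i.+1); rewrite s_i sj !adjE eqxx /=.
case/orP=> [/eqP ij|/eqP/eq_mod4 ji]; first by rewrite eq_cyc ij.
have := s_adj (hub k i) (cyc k i.+1); rewrite s_hub sj !adjE; lia.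
Qed.

Lemma aut_fix_cyc0 k s : s \in graph_aut (@Gamma (4 * k.+1)) ->
  s (cyc k 0) = cyc k 0 -> s = 1%g.
Proof.
move=> s_aut s_0; have s_cyc i : s (cyc k i) = cyc k i.
  by elim: i => // i IHi; have [] := aut_fix_next s_aut IHi.
apply/permP => x; rewrite perm1.
case: (vertexP x) => [i|a|b]; first exact: s_cyc.
  by have [] := aut_fix_next s_aut (s_cyc a).
by have [] := aut_fix_next s_aut (s_cyc b).
Qed.

(** * The rotation and the automorphism group *)

Definition turn k (x : 'I_(4 * k.+1 + 6)) : 'I_(4 * k.+1 + 6) :=
  if x < 4 * k.+1 then cyc k x.+1
  else if x < 4 * k.+1 + 4 then hub k (x - 4 * k.+1).+1
  else pole k (x - (4 * k.+1 + 4)).+1.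

Lemma turn_cyc k i : turn (cyc k i) = cyc k i.+1.
Proof.
rewrite /turn /= ltn_pmod //; apply/eqP.
by rewrite eq_cyc -addn1 modnDml addn1.
Qed.

Lemma turn_hub k a : turn (hub k a) = hub k a.+1.
Proof.
rewrite /turn /= ltnNge leq_addr ltn_add2l ltn_pmod //=; apply/eqP.
by rewrite eq_hub; lia.
Qed.

Lemma turn_pole k b : turn (pole k b) = pole k b.+1.
Proof.
rewrite /turn /= !ifF; [|lia|lia]; apply/eqP.
by rewrite eq_pole; lia.
Qed.

Lemma iter_turn_cyc k j i : iter j (@turn k) (cyc k i) = cyc k (i + j).
Proof.
by elim: j => [|j IHj]; rewrite ?addn0 // iterS IHj turn_cyc (addnS _ j).
Qed.

Lemma iter_turn_hub k j a : iter j (@turn k) (hub k a) = hub k (a + j).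
Proof.
by elim: j => [|j IHj]; rewrite ?addn0 // iterS IHj turn_hub (addnS _ j).
Qed.

Lemma iter_turn_pole k j b : iter j (@turn k) (pole k b) = pole k (b + j).
Proof.
by elim: j => [|j IHj]; rewrite ?addn0 // iterS IHj turn_pole (addnS _ j).
Qed.

Lemma iter_turn k : iter (4 * k.+1) (@turn k) =1 id.
Proof.
move=> x; apply/eqP; case: (vertexP x) => [i|a|b].
- by rewrite iter_turn_cyc eq_cyc modnDr.
- by rewrite iter_turn_hub eq_hub; lia.
- by rewrite iter_turn_pole eq_pole; lia.
Qed.

(** A map with an iterate equal to the identity has the previous iterate as its
inverse. *)
Lemma turn_inj k : injective (@turn k).
Proof.
apply: (can_inj (g := iter (4 * k.+1).-1 (@turn k))) => x.
by rewrite -iterSr prednK // iter_turn.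
Qed.

Definition rotation k : {perm 'I_(4 * k.+1 + 6)} := perm (@turn_inj k).

Lemma rotation_aut k : rotation k \in graph_aut (@Gamma (4 * k.+1)).
Proof.
apply/graph_autP => x y; rewrite !permE.
have eq_modS m i j : (i.+1 == j.+1 %[mod m]) = (i == j %[mod m]).
  by rewrite -(addn1 i) -(addn1 j) eqn_modDr.
case: (vertexP x) => [i|a|b]; case: (vertexP y) => [j|c|d];
  by rewrite ?turn_cyc ?turn_hub ?turn_pole !adjE ?eq_modS.
Qed.

Lemma rotationX_cyc0 k j : (rotation k ^+ j)%g (cyc k 0) = cyc k j.
Proof.
rewrite permX (eq_iter (f' := @turn k)) ?iter_turn_cyc // => x.
exact: permE.
Qed.

Lemma order_rotation k : #[rotation k]%g = 4 * k.+1.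
Proof.
apply/eqP; rewrite eqn_dvd; apply/andP; split.
  rewrite order_dvdn; apply/eqP/permP => x; rewrite permX perm1.
  rewrite (eq_iter (f' := @turn k)) ?iter_turn // => z; exact: permE.
have /permP/(_ (cyc k 0))/eqP := expg_order (rotation k).
by rewrite rotationX_cyc0 perm1 eq_cyc mod0n.
Qed.

Lemma graph_aut_rotation k : graph_aut (@Gamma (4 * k.+1)) = <[rotation k]>%G.
Proof.
apply/group_inj/eqP; rewrite eq_sym eqEsubset cycle_subG rotation_aut /=.
apply/subsetP => s s_aut; have [j s0] := aut_cyc 0 s_aut.
suff /eqP : (s * (rotation k ^+ j)^-1)%g = 1%g.
  by rewrite -eq_mulgV1 => /eqP->; rewrite mem_cycle.
apply: aut_fix_cyc0; first by rewrite groupM ?groupV ?groupX ?rotation_aut.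
by rewrite permM s0 -rotationX_cyc0 permK.
Qed.

Theorem proposition2p5 (n : nat) (hn : 2 <= n) :
  graph_aut (@Gamma (2 ^ n)) \isog [set: 'Z_(2 ^ n)].
Proof.
have [k ->] : exists k, 2 ^ n = 4 * k.+1.
  exists (2 ^ (n - 2)).-1.
  by rewrite prednK ?expn_gt0 // -(expnD 2 2) subnKC.
have := Zp_isog (rotation k).
rewrite order_rotation graph_aut_rotation isog_sym.
have <- // : Zp (4 * k.+1) = [set: 'Z_(4 * k.+1)].
by rewrite /Zp ifT; last by lia.
Qed.
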